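(* Let $\Omega\subset\mathbb{R}^d$ be a closed $\eta$-prox-regular set. Assume either (i) $\Omega$ is bounded and $W,V\in C^1(\mathbb{R}^d)$ are respectively $\lambda_W$-geodesically convex on $\mathrm{Conv}(\Omega-\Omega)$ and $\lambda_V$-geodesically convex on $\mathrm{Conv}(\Omega)$; or (ii) $\Omega$ is unbounded and $W,V\in C^1(\mathbb{R}^d)$ satisfy $|\nabla W(x)|\le C(1+|x|)$ and $|\nabla V(x)|\le C(1+|x|)$ for all $x$. Then for any $n\in\mathbb{N}$, any $(x_1,\dots,x_n)\in\Omega^n$ and any $(m_1,\dots,m_n)$ with $m_i\ge0$, $\sum_im_i=1$, the system $$\dot x_i(t)=P_{x_i(t)}\Big(-\sum_{j=1}^nm_j\nabla W(x_i(t)-x_j(t))-\nabla V(x_i(t))\Big),\qquad x_i(0)=x_i\in\Omega,\qquad i=1,\dots,n,$$ has a locally absolutely continuous solution (the equations holding for a.e. $t\ge0$).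
   Context: For closed $S$, $P_S(y)$ is the set of nearest points; proximal normal cone $N^P(S,x)=\{v:\exists\alpha>0,\ x\in P_S(x+\alpha v)\}$; $S$ is $\eta$-prox-regular if for all $x\in\partial S$, $v\in N^P(S,x)$, $|v|=1$, the open ball $B_\eta(x+\eta v)$ misses $S$. $T(\Omega,x)$ is the Clarke tangent cone ($v$ such that for all $t_n\searrow0$, $x_n\in\Omega$, $x_n\to x$, there exist $v_n\to v$ with $x_n+t_nv_n\in\Omega$), and $P_x(w)$ is the nearest point of $T(\Omega,x)$ to $w$. $f$ is $\lambda$-geodesically convex on convex $K$ if $f(y)\ge f(x)+\langle\nabla f(x),y-x\rangle+\frac\lambda2|y-x|^2$ on $K$; $\mathrm{Conv}$ is convex hull and $\Omega-\Omega=\{x-y:x,y\in\Omega\}$. *)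

(* Defs.v *)
From HB Require Import structures.
From mathcomp Require Import all_boot all_order all_algebra.
From mathcomp Require Import all_classical all_reals all_analysis.
Set Implicit Arguments. Unset Strict Implicit. Unset Printing Implicit Defensive.
Import Order.TTheory GRing.Theory Num.Theory numFieldNormedType.Exports.
Local Open Scope classical_set_scope.
Local Open Scope ring_scope.

Section Defs.
Context {R : realType} {d : nat}.
Local Notation V := 'rV[R]_d.

Definition dotp (u v : V) : R := \sum_(i < d) u ord0 i * v ord0 i.
Definition enorm (u : V) : R := Num.sqrt (dotp u u).

Definition nearest (S : set V) (y x : V) : Prop :=
  S x /\ forall z, S z -> enorm (y - x) <= enorm (y - z).

Definition prox_normal (S : set V) (x v : V) : Prop :=
  exists alpha : R, 0 < alpha /\ nearest S (x + alpha *: v) x.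

Definition bdry (S : set V) : set V := closure S `\` interior S.

Definition prox_regular (eta : R) (S : set V) : Prop :=
  forall x v, bdry S x -> prox_normal S x v -> enorm v = 1 ->
    forall y, S y -> ~ (enorm (y - (x + eta *: v)) < eta).

Definition clarke_tangent (S : set V) (x v : V) : Prop :=
  forall (t : nat -> R) (xs : nat -> V),
    (forall n, 0 < t n) -> t n @[n --> \oo] --> 0 ->
    (forall n, S (xs n)) -> xs n @[n --> \oo] --> x ->
    exists vs : nat -> V, vs n @[n --> \oo] --> v /\
      forall n, S (xs n + t n *: vs n).

Definition tangent_proj (S : set V) (x w p : V) : Prop :=
  nearest (clarke_tangent S x) w p.

Definition C1_grad (f : V -> R) (g : V -> V) : Prop :=
  continuous g /\
  forall x, differentiable f x /\ forall h, 'd f x h = dotp (g x) h.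

Definition geod_convex (lambda : R) (f : V -> R) (g : V -> V) (K : set V) :=
  forall x y, K x -> K y ->
    f x + dotp (g x) (y - x) + lambda / 2 * enorm (y - x) ^+ 2 <= f y.

Definition conv_hull (A : set V) : set V :=
  [set z | exists (n : nat) (w : 'I_n -> R) (p : 'I_n -> V),
     (forall i, 0 <= w i) /\ \sum_(i < n) w i = 1 /\ (forall i, A (p i)) /\
     z = \sum_(i < n) w i *: p i].

Definition set_diff_minus (A : set V) : set V :=
  [set z | exists x y, A x /\ A y /\ z = x - y].

Definition ebounded (A : set V) : Prop :=
  exists M : R, forall x, A x -> enorm x <= M.

Definition abs_cont_on (f : R -> V) (a b : R) : Prop :=
  forall eps : R, 0 < eps -> exists delta : R, 0 < delta /\
    forall (n : nat) (l r : 'I_n -> R),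
      (forall k, a <= l k /\ l k <= r k /\ r k <= b) ->
      (forall k k', k != k' -> r k <= l k' \/ r k' <= l k) ->
      \sum_(k < n) (r k - l k) < delta ->
      \sum_(k < n) enorm (f (r k) - f (l k)) < eps.

Definition loc_abs_cont (f : R -> V) : Prop :=
  forall T : R, 0 <= T -> abs_cont_on f 0 T.

End Defs.

(* Main.v *)
(* Projected Euler steps [X(k+1) = P_Om (X(k) + h G(X(k)))] keep every particle in [Om], and the
   linear growth of [G] bounds them and makes them Lipschitz on bounded time intervals.
   Prox-regularity says that [<z - p, y - p> <= |z - p| |y - p|^2 / (2 eta)] whenever [p] is
   nearest to [z] and [y] lies in [Om]; along the scheme it yields a discrete evolution
   variational inequality for [|x_i - y|^2].  The limit along an ultrafilter as [h -> 0] is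
   locally Lipschitz, hence differentiable almost everywhere, and at a point of
   differentiability the inequality becomes [<G - x', y - x> <= K |y - x|^2] for all [y] in [Om].
   So [G - x'] is polar to the contingent cone, which for prox-regular sets is the Clarke
   tangent cone; since the curve stays in [Om] before and after [t], both [x'] and [- x'] are
   tangent, and [x'] is the projection of [G] on the tangent cone.  Under (i) the growth bound
   comes from continuity of the gradients on bounded sets. *)
Require Import Defs.
From HB Require Import structures.
From mathcomp Require Import all_boot all_order all_algebra.
From mathcomp Require Import all_classical all_reals all_analysis.
From mathcomp Require Import ring lra.
Set Implicit Arguments. Unset Strict Implicit. Unset Printing Implicit Defensive.
Import Order.TTheory GRing.Theory Num.Theory numFieldNormedType.Exports.
Local Open Scope classical_set_scope.
Local Open Scope ring_scope.

(** * Euclidean geometry of row vectors *)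

Lemma cvg_sumr {K : numFieldType} {U : normedModType K} {T I : Type}
    (F : set_system T) {FF : Filter F} (r : seq I) (f : I -> T -> U) (l : I -> U) :
  (forall i, f i x @[x --> F] --> l i) ->
  \sum_(i <- r) f i x @[x --> F] --> \sum_(i <- r) l i.
Proof.
move=> fl; elim: r => [|i r IHr].
  by rewrite big_nil; under eq_cvg do rewrite big_nil; exact: cvg_cst.
by rewrite big_cons; under eq_cvg do rewrite big_cons; exact: cvgD.
Qed.

Section Euclidean.
Context {R : realType} {d : nat}.
Local Notation V := 'rV[R]_d.
Implicit Types (u v w x y z : V) (a b : R).

Lemma dotpC u v : dotp u v = dotp v u.
Proof. by apply: eq_bigr => i _; rewrite mulrC. Qed.

Lemma dotpDl u v w : dotp (u + v) w = dotp u w + dotp v w.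
Proof. by rewrite -big_split; apply: eq_bigr => i _; rewrite mxE mulrDl. Qed.

Lemma dotpZl a u v : dotp (a *: u) v = a * dotp u v.
Proof. by rewrite mulr_sumr; apply: eq_bigr => i _; rewrite mxE mulrA. Qed.

Lemma dotpDr u v w : dotp w (u + v) = dotp w u + dotp w v.
Proof. by rewrite !(dotpC w) dotpDl. Qed.

Lemma dotpZr a u v : dotp u (a *: v) = a * dotp u v.
Proof. by rewrite !(dotpC u) dotpZl. Qed.

Lemma dotpNl u v : dotp (- u) v = - dotp u v.
Proof. by rewrite -scaleN1r dotpZl mulN1r. Qed.

Lemma dotpNr u v : dotp u (- v) = - dotp u v.
Proof. by rewrite !(dotpC u) dotpNl. Qed.

Definition dotpE := (dotpDl, dotpDr, dotpNl, dotpNr, dotpZl, dotpZr).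

Lemma dotp_ge0 u : 0 <= dotp u u.
Proof. by apply: sumr_ge0 => i _; rewrite -expr2 sqr_ge0. Qed.

Lemma enorm_ge0 u : 0 <= enorm u. Proof. exact: sqrtr_ge0. Qed.

Lemma sqr_enorm u : enorm u ^+ 2 = dotp u u.
Proof. by rewrite sqr_sqrtr// dotp_ge0. Qed.

Lemma dotp0l v : dotp 0 v = 0.
Proof. by rewrite -(scale0r 0) dotpZl mul0r. Qed.

Lemma enorm0 : enorm (0 : V) = 0.
Proof. by rewrite /enorm dotp0l sqrtr0. Qed.

Lemma coord_le_enorm u i : `|u ord0 i| <= enorm u.
Proof.
rewrite -sqrtr_sqr ler_wsqrtr// /dotp (bigD1 i)//= expr2 lerDl.
by apply: sumr_ge0 => j _; rewrite -expr2 sqr_ge0.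
Qed.

Lemma enorm_eq0 u : enorm u = 0 -> u = 0.
Proof.
move=> u0; apply/rowP => i; rewrite mxE; apply/eqP; rewrite -normr_le0 -u0.
exact: coord_le_enorm.
Qed.

Lemma enormZ a u : enorm (a *: u) = `|a| * enorm u.
Proof.
by rewrite /enorm !dotpE mulrA -expr2 sqrtrM ?sqr_ge0// sqrtr_sqr.
Qed.

Lemma enormN u : enorm (- u) = enorm u.
Proof. by rewrite -scaleN1r enormZ normrN1 mul1r. Qed.

Lemma enormB u v : enorm (u - v) = enorm (v - u).
Proof. by rewrite -enormN opprB. Qed.

Lemma dotp_le_enorm u v : dotp u v <= enorm u * enorm v.
Proof.
have [/enorm_eq0->|u0] := eqVneq (enorm u) 0; first by rewrite dotp0l enorm0 mul0r.
have [/enorm_eq0->|v0] := eqVneq (enorm v) 0.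
  by rewrite dotpC dotp0l enorm0 mulr0.
have up : 0 < enorm u by rewrite lt_def u0 enorm_ge0.
have vp : 0 < enorm v by rewrite lt_def v0 enorm_ge0.
have := dotp_ge0 (enorm v *: u - enorm u *: v).
rewrite !dotpE -!sqr_enorm (dotpC v u) => h.
rewrite -(ler_pM2l (mulr_gt0 up vp)); nra.
Qed.

Lemma ler_enormD u v : enorm (u + v) <= enorm u + enorm v.
Proof.
rewrite -ler_sqr ?nnegrE ?addr_ge0 ?enorm_ge0// sqr_enorm !dotpE.
rewrite sqrrD !sqr_enorm (dotpC v u); have := dotp_le_enorm u v; nra.
Qed.

Lemma sqr_enormBZ a u v : enorm (u - a *: v) ^+ 2 =
  enorm u ^+ 2 - 2 * a * dotp v u + a ^+ 2 * enorm v ^+ 2.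
Proof. by rewrite !sqr_enorm !dotpE (dotpC u v); ring. Qed.

(** The mean of the squares is the square of the mean plus the variance. *)
Lemma sqr_enorm_barycenter a u v :
  (1 - a) * enorm u ^+ 2 + a * enorm v ^+ 2 =
  enorm ((1 - a) *: u + a *: v) ^+ 2 + a * (1 - a) * enorm (v - u) ^+ 2.
Proof. by rewrite !sqr_enorm !dotpE (dotpC v u); ring. Qed.

Lemma ler_enormB u v : enorm (u - v) <= enorm u + enorm v.
Proof. by rewrite -(enormN v) ler_enormD. Qed.

Lemma ler_enorm_dist y u v : enorm (u - v) <= enorm (u - y) + enorm (y - v).
Proof. by rewrite -{1}(subrK y u) -addrA ler_enormD. Qed.

Lemma ler_enorm_sum (I : Type) (r : seq I) (P : pred I) (F : I -> V) :
  enorm (\sum_(i <- r | P i) F i) <= \sum_(i <- r | P i) enorm (F i).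
Proof.
elim/big_rec2: _ => [|i a u _ h]; first by rewrite enorm0.
by rewrite (le_trans (ler_enormD _ _))// lerD2l.
Qed.

Lemma norm_le_enorm u : `|u| <= enorm u.
Proof.
rewrite [leLHS]/Num.norm/= mx_normrE; apply/bigmax_leP; split; first exact: enorm_ge0.
by move=> [i j] _ /=; rewrite (ord1 i) coord_le_enorm.
Qed.

Lemma cvg_dotp {T : Type} (F : set_system T) {FF : Filter F} (f g : T -> V) u v :
  f @ F --> u -> g @ F --> v -> dotp (f x) (g x) @[x --> F] --> dotp u v.
Proof.
move=> fu gv; apply: cvg_sumr => i.
have coord w (h : T -> V) : h @ F --> w -> h x ord0 i @[x --> F] --> w ord0 i.
  by move=> hw; exact: (cvg_comp _ _ hw (@coord_continuous R 1 d ord0 i w)).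
by apply: cvgM; exact: coord.
Qed.

Lemma cvg_enorm {T : Type} (F : set_system T) {FF : Filter F} (f : T -> V) u :
  f @ F --> u -> enorm (f x) @[x --> F] --> enorm u.
Proof.
move=> fu; exact: (cvg_comp _ _ (cvg_dotp fu fu) (@sqrt_continuous R _)).
Qed.

(** The topology of row vectors comes from the sup norm; [norm_le_enorm] and the continuity of
    [enorm] let Euclidean balls describe it. *)
Lemma cvg_enormP {T : Type} (F : set_system T) {FF : Filter F} (f : T -> V) u :
  f @ F --> u <-> forall e, 0 < e -> \forall x \near F, enorm (f x - u) < e.
Proof.
split=> [fu e e0|h].
  have : enorm (f x - u) @[x --> F] --> enorm (u - u).
    by apply: cvg_enorm; apply: cvgB => //; exact: cvg_cst.
  rewrite subrr enorm0 => /cvgr0Pnorm_lt /(_ _ e0); apply: filterS => x.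
  by rewrite ger0_norm// enorm_ge0.
apply/cvgrPdist_lt => e e0; apply: filterS (h _ e0) => x.
by apply: le_lt_trans; rewrite distrC norm_le_enorm.
Qed.

End Euclidean.

(** * Prox-regular sets and tangent cones *)

Section ProxRegular.
Context {R : realType} {d : nat}.
Local Notation V := 'rV[R]_d.
Implicit Types (S : set V) (eta : R).

Lemma enorm_continuous : continuous (@enorm R d).
Proof. by move=> x; exact: (@cvg_enorm _ _ _ (nbhs x) _ id x cvg_id). Qed.

Lemma nearest_exists S (y : V) : closed S -> S !=set0 -> exists p, nearest S y p.
Proof.
move=> cS [a Sa].
have cf : continuous (fun z : V => enorm (y - z)).
  by move=> z; apply: (@cvg_enorm _ _ _ (nbhs z) _ (fun z => y - z) (y - z)); apply: cvgB; [exact: cvg_cst|exact: cvg_id].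
(* Only points at least as close to [y] as [a] compete, and they form a compact set. *)
pose K := S `&` [set z | enorm (y - z) <= enorm (y - a)].
have Ka : K a by split => //=.
have cK : compact K.
  apply: bounded_closed_compact.
    exists (enorm y + enorm (y - a)); split; first exact: num_real.
    move=> M hM z [_ /= hz]; apply: le_trans (ltW hM).
    rewrite (le_trans (norm_le_enorm z))// -{1}(subKr y z).
    by rewrite (le_trans (ler_enormB _ _))// lerD2l.
  apply: closedI => //.
  exact: ((continuous_closedP _).1 cf _ (@closed_le _ (enorm (y - a)))).
have [|p /set_mem [Sp _] hp] := @EVT_min_rV R d (fun z => enorm (y - z)) K (ex_intro _ a Ka) cK.
  exact: continuous_subspaceT.
exists p; split => // z Sz.
have [hz|/ltW hz] := leP (enorm (y - z)) (enorm (y - a)).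
  by apply: hp; apply/mem_set.
by apply: le_trans hz; apply: hp; apply/mem_set.
Qed.

(** Nearest points need not be unique far from [S], so one is chosen; the default [0] appears only
    when there is none. *)
Definition nproj S (y : V) : V := xget 0 (nearest S y).

Lemma nprojP S (y : V) : closed S -> S !=set0 -> nearest S y (nproj S y).
Proof. by move=> cS S0; have [p yp] := nearest_exists y cS S0; exact: (xgetI 0 yp). Qed.

(** The unit vector [u] along [z - p] is a proximal normal at [p], so [y] avoids the open ball of
    radius [eta] around [p + eta *: u]. Expanding the squared distance to this centre bounds
    [dotp u (y - p)], and scaling by [|z - p|] concludes. *)
Lemma prox_ineq S eta (z p y : V) : 0 < eta -> prox_regular eta S ->
  nearest S z p -> S y ->
  dotp (z - p) (y - p) <= enorm (z - p) / (2 * eta) * enorm (y - p) ^+ 2.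
Proof.
move=> eta0 pS [Sp hp] Sy.
have [->|zp] := eqVneq z p; first by rewrite subrr dotp0l enorm0 !mul0r.
have r0 : 0 < enorm (z - p).
  rewrite lt_def enorm_ge0 andbT; apply: contra zp => /eqP/enorm_eq0/eqP.
  by rewrite subr_eq0.
set r := enorm (z - p) in r0 *.
have [u zpE nu] : exists2 u, z - p = r *: u & enorm u = 1.
  exists (r^-1 *: (z - p)); first by rewrite scalerA divff ?scale1r// gt_eqF.
  by rewrite enormZ ger0_norm ?invr_ge0 ?ltW// mulVf// gt_eqF.
(* From an interior point [p] a short move towards [z] would stay in [S] and come strictly closer to
   [z]. *)
have bp : bdry S p.
  split; first exact: subset_closure.
  move=> /nbhs_ballP[e /= e0 he].
  pose s := Num.min (1 / 2) (e / 2 / r).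
  have s0 : 0 < s by rewrite lt_min !divr_gt0.
  have s1 : s <= 1 / 2 by rewrite ge_min lexx.
  have se : s <= e / 2 / r by rewrite ge_min lexx orbT.
  have /hp : S (p + s *: (z - p)).
    apply: he; rewrite -ball_normE /ball_/= opprD addNKr normrN.
    apply: le_lt_trans (norm_le_enorm _) _.
    rewrite enormZ ger0_norm ?ltW// -/r (@le_lt_trans _ _ (e / 2))//.
      by rewrite -ler_pdivlMr.
    by rewrite ltr_pdivrMr// ltr_pMr// ltr1n.
  have -> : z - (p + s *: (z - p)) = (1 - s) *: (z - p).
    by rewrite scalerBl scale1r opprD addrA.
  rewrite enormZ ger0_norm ?subr_ge0; last by lra.
  by rewrite -/r -subr_ge0; nra.
have pn : prox_normal S p u.
  exists r; split => //; split => // x Sx.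
  have -> : p + r *: u = z by rewrite -zpE addrC subrK.
  exact: hp.
have /negP := pS p u bp pn nu y Sy; rewrite -leNgt => h.
have : eta ^+ 2 <= enorm (y - (p + eta *: u)) ^+ 2.
  by rewrite ler_sqr ?nnegrE ?enorm_ge0// ltW.
rewrite opprD addrA; set w := y - p.
rewrite sqr_enormBZ nu zpE dotpZl => hw.
have huw : dotp u w <= (2 * eta)^-1 * enorm w ^+ 2.
  by rewrite mulrC ler_pdivlMr ?mulr_gt0//; lra.
by rewrite -mulrA ler_wpM2l// ltW.
Qed.

(** Chords deviate from [S] only quadratically. Averaging [prox_ineq] at both ends with weights
    [1 - l] and [l] gives [r ^+ 2] on the left and, by the barycenter identity,
    [r ^+ 2 + l * (1 - l) * D ^+ 2] times [r / (2 * eta)] on the right. After division by [r], the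
    bound [r <= eta] absorbs the remaining square. *)
Lemma segment_dist S eta (a b p : V) (l : R) : 0 < eta -> prox_regular eta S ->
  S a -> S b -> 0 <= l <= 1 -> enorm (b - a) <= eta ->
  nearest S (a + l *: (b - a)) p ->
  enorm (a + l *: (b - a) - p) <= l * enorm (b - a) ^+ 2 / eta.
Proof.
move=> eta0 pS Sa Sb /andP[l0 l1] ab np; set z := a + _ in np *; set r := enorm _.
have pa := prox_ineq eta0 pS np Sa; have pb := prox_ineq eta0 pS np Sb.
rewrite -/r in pa pb.
have r0 : 0 <= r by exact: enorm_ge0.
have rl : r <= l * enorm (b - a).
  apply: le_trans (np.2 a Sa) _.
  by rewrite /z addrC addKr enormZ ger0_norm.
have reta : r <= eta.
  by apply: le_trans rl _; apply: le_trans ab; rewrite ler_piMl ?enorm_ge0.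
have zE : z - p = (1 - l) *: (a - p) + l *: (b - p).
  by rewrite /z; apply/rowP => i; rewrite !mxE; ring.
have rE : r ^+ 2 = (1 - l) * dotp (z - p) (a - p) + l * dotp (z - p) (b - p).
  by rewrite /r sqr_enorm [X in dotp _ X]zE [LHS]dotpDr !dotpZr.
have var := sqr_enorm_barycenter l (a - p) (b - p).
rewrite -zE -/r opprB addrA subrK in var.
set D := enorm (b - a) in ab rl var *.
have D0 : 0 <= D by exact: enorm_ge0.
have h2 : r ^+ 2 <= r / (2 * eta) * (r ^+ 2 + l * (1 - l) * D ^+ 2).
  by rewrite -var rE mulrDr; apply: lerD; rewrite mulrCA; apply: ler_wpM2l; rewrite ?subr_ge0.
have [rn0|rn0] := eqVneq r 0.
  by rewrite rn0 divr_ge0 ?mulr_ge0 ?sqr_ge0// ltW.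
have rp : 0 < r by rewrite lt_def rn0.
have : 2 * eta * r <= r ^+ 2 + l * (1 - l) * D ^+ 2.
  move: h2; rewrite [leLHS]expr2 -mulrA (ler_pM2l rp).
  by rewrite ler_pdivlMl ?mulr_gt0.
rewrite ler_pdivlMr// => h3.
have h4 : r ^+ 2 <= eta * r by rewrite expr2 ler_wpM2r.
have h5 : l * (1 - l) * D ^+ 2 <= l * D ^+ 2.
  by rewrite ler_wpM2r ?sqr_ge0// ler_piMr//; lra.
lra.
Qed.

(** Bouligand's cone without sequences: a single tolerance bounds both the step and the relative
    error. *)
Definition contingent S (x v : V) : Prop := forall e, 0 < e ->
  exists h y, [/\ 0 < h, h < e, S y & enorm (y - x - h *: v) <= e * h].

(** The Clarke condition is tested on the constant sequence [x] with harmonic times. *)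
Lemma clarke_contingent S (x v : V) : S x -> clarke_tangent S x v -> contingent S x v.
Proof.
move=> Sx xv e e0.
have [||vs [vsv Svs]] := xv (@harmonic R) (fun=> x) _ (@cvg_harmonic R) (fun=> Sx).
- by move=> n; exact: harmonic_gt0.
- exact: cvg_cst.
have ev1 : \forall n \near \oo, harmonic n < e.
  have /cvgrPdist_lt /(_ e e0) := @cvg_harmonic R; apply: filterS => n.
  by rewrite sub0r normrN gtr0_norm// harmonic_gt0.
have /cvg_enormP /(_ e e0) ev2 := vsv.
near \oo => n.
exists (harmonic n), (x + harmonic n *: vs n); split => //.
- exact: harmonic_gt0.
- by near: n.
rewrite (addrC x) addrK -scalerBr enormZ gtr0_norm ?harmonic_gt0// mulrC.
by rewrite ler_pM2r ?harmonic_gt0// ltW//; near: n.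
Unshelve. all: by end_near. Qed.

(** Along points [y = x + h v + o(h)] of [S] the left side is [h <q, v> + o(h)] and the right side
    is [O(h^2)]; divide by [h]. *)
Lemma contingent_polar S (K : R) (x q v : V) : 0 <= K ->
  (forall y, S y -> dotp q (y - x) <= K * enorm (y - x) ^+ 2) ->
  contingent S x v -> dotp q v <= 0.
Proof.
move=> K0 hq xv; apply/ler_addgt0Pr => e e0; rewrite add0r.
(* [A] adds up the error coefficients: [enorm q] for the remainder and the [K] term for the
   quadratic bound; the final [1] keeps it positive. *)
pose A := enorm q + K * (enorm v + 1) ^+ 2 + 1.
have B0 : 0 <= K * (enorm v + 1) ^+ 2 by rewrite mulr_ge0// sqr_ge0.
have A0 : 0 < A by have := enorm_ge0 q; rewrite /A; lra.
pose e' := Num.min 1 (e / A).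
have e'0 : 0 < e' by rewrite lt_min ltr01 divr_gt0.
have e'1 : e' <= 1 by rewrite ge_min lexx.
have e'2 : e' * A <= e by rewrite -ler_pdivlMr// ge_min lexx orbT.
have [h [y [h0 he Sy hy]]] := xv e' e'0.
have yx : y - x = h *: v + (y - x - h *: v) by rewrite [RHS]addrC subrK.
have ny : enorm (y - x) <= h * (enorm v + 1).
  rewrite yx (le_trans (ler_enormD _ _))// enormZ gtr0_norm//; nra.
have ny2 : enorm (y - x) ^+ 2 <= h * (e' * (enorm v + 1) ^+ 2).
  apply: (@le_trans _ _ ((h * (enorm v + 1)) ^+ 2)).
    by rewrite ler_sqr ?nnegrE ?enorm_ge0// mulr_ge0 ?addr_ge0 ?enorm_ge0 ?ltW.
  by rewrite exprMn expr2 -mulrA ler_pM2l// ler_wpM2r ?sqr_ge0// ltW.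
have dq : - dotp q (y - x - h *: v) <= enorm q * (e' * h).
  rewrite -dotpNr (le_trans (dotp_le_enorm _ _))// enormN.
  by rewrite ler_wpM2l ?enorm_ge0.
have h1 : h * dotp q v <= h * (e' * A).
  have := hq y Sy; rewrite {1}yx dotpDr dotpZr => h2.
  have h3 : K * enorm (y - x) ^+ 2 <= K * (h * (e' * (enorm v + 1) ^+ 2)).
    by rewrite ler_wpM2l.
  have : h * (e' * A) = enorm q * (e' * h) + K * (h * (e' * (enorm v + 1) ^+ 2)) + h * e'.
    by rewrite /A; ring.
  have : 0 < h * e' by rewrite mulr_gt0.
  lra.
by move: h1; rewrite ler_pM2l// => /le_trans; apply.
Qed.

(* A set point [y] close to [x + h *: v] is joined by a chord to [xs n]; following the
   chord for the time fraction [t n / h] and projecting costs only [O(t n * h)]. *)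
Lemma contingent_clarke S eta (x v : V) : 0 < eta -> closed S -> prox_regular eta S ->
  contingent S x v -> clarke_tangent S x v.
Proof.
move=> eta0 cS pS xv t xs t0 tcv Sxs xscv.
pose p n := nproj S (xs n + t n *: v).
have S0 : S !=set0 by exists (xs 0%N).
have pP n : nearest S (xs n + t n *: v) (p n) by exact: nprojP.
exists (fun n => (t n)^-1 *: (p n - xs n)); split; last first.
  move=> n; rewrite scalerA divff ?gt_eqF// scale1r addrC subrK.
  by case: (pP n).
apply/cvg_enormP => e e0.
(* [M * h] will bound the chord [y - xs n], and [c] collects the coefficients of [e' * t n] in the
   final error. The three bounds on [e'] respectively yield this chord bound, make the chord no
   longer than [eta] as [segment_dist] requires, and bring the error below [e / 2]. *)
pose M := enorm v + 2.
have M0 : 0 < M by rewrite /M; have := enorm_ge0 v; lra.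
pose c := 2 + M ^+ 2 / eta.
have c0 : 0 < c by rewrite addr_gt0// divr_gt0// exprn_gt0.
pose e' := Num.min 1 (Num.min (eta / M) (e / 2 / c)).
have e'0 : 0 < e' by rewrite !lt_min ltr01 !divr_gt0.
have e'1 : e' <= 1 by rewrite ge_min lexx.
have e'2 : e' <= eta / M by rewrite !ge_min lexx orbT.
have e'3 : e' <= e / 2 / c by rewrite !ge_min lexx !orbT.
have [h [y [h0 he' Sy hy]]] := xv e' e'0.
have ev1 : \forall n \near \oo, t n < h.
  by have /cvgrPdist_lt /(_ h h0) := tcv; apply: filterS => n; rewrite sub0r normrN gtr0_norm.
have ev2 : \forall n \near \oo, enorm (xs n - x) < e' * h.
  by have /cvg_enormP := xscv; apply; rewrite mulr_gt0.
near=> n.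
have tnh : t n < h by near: n.
have xn : enorm (xs n - x) < e' * h by near: n.
have tn0 := t0 n.
pose l := t n / h.
have l01 : 0 <= l <= 1.
  by apply/andP; split; [rewrite divr_ge0 ?ltW|rewrite ler_pdivrMr// mul1r ltW].
have yE : y - xs n - h *: v = (y - x - h *: v) - (xs n - x).
  by apply/rowP => i; rewrite !mxE; ring.
have hyn : enorm (y - xs n - h *: v) <= 2 * e' * h.
  by rewrite yE (le_trans (ler_enormB _ _))//; lra.
have ab : enorm (y - xs n) <= M * h.
  rewrite -(subrK (h *: v) (y - xs n)) (le_trans (ler_enormD _ _))//.
  rewrite enormZ gtr0_norm// /M; nra.
have abeta : enorm (y - xs n) <= eta.
  apply: le_trans ab _; rewrite mulrC -ler_pdivlMr//; lra.
have nq := nprojP (xs n + l *: (y - xs n)) cS S0.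
set q := nproj _ _ in nq.
have dq := segment_dist eta0 pS (Sxs n) Sy l01 abeta nq.
have lh : l * h = t n by rewrite /l -mulrA mulVf ?mulr1// gt_eqF.
have d1 : enorm (xs n + t n *: v - (xs n + l *: (y - xs n))) <= 2 * e' * t n.
  have -> : xs n + t n *: v - (xs n + l *: (y - xs n)) = - (l *: (y - xs n - h *: v)).
    by rewrite -lh; apply/rowP => i; rewrite !mxE; ring.
  rewrite enormN enormZ ger0_norm; last by case/andP: l01.
  rewrite -lh (mulrCA _ l) ler_wpM2l//; first by case/andP: l01.
(* As a nearest point, [p n] does at least as well as [q], the projection of the chord point. *)
have d2 : enorm (xs n + t n *: v - p n) <= (2 * e' + M ^+ 2 / eta * e') * t n.
  apply: le_trans ((pP n).2 q nq.1) _.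
  apply: le_trans (ler_enorm_dist (xs n + l *: (y - xs n)) _ _) _.
  rewrite mulrDl lerD//; apply: le_trans dq _.
  have -> : M ^+ 2 / eta * e' * t n = l * (e' * (M ^+ 2 * h)) / eta.
    by rewrite -lh; ring.
  rewrite ler_pM2r ?invr_gt0// ler_wpM2l//; first by case/andP: l01.
  apply: (@le_trans _ _ ((M * h) ^+ 2)).
    by rewrite ler_sqr ?nnegrE ?enorm_ge0// mulr_ge0// ltW.
  have M2 : 0 < M ^+ 2 by rewrite exprn_gt0.
  by rewrite exprMn [h ^+ 2]expr2 mulrA [leRHS]mulrC ler_pM2l ?mulr_gt0// ltW.
have -> : (t n)^-1 *: (p n - xs n) - v = - ((t n)^-1 *: (xs n + t n *: v - p n)).
  by apply/rowP => i; rewrite !mxE; field; rewrite gt_eqF.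
rewrite enormN enormZ gtr0_norm ?invr_gt0// ltr_pdivrMl//.
apply: le_lt_trans d2 _; rewrite [ltRHS]mulrC ltr_pM2r//.
have : e' * c <= e / 2 by rewrite -ler_pdivlMr.
rewrite /c; lra.
Unshelve. all: by end_near. Qed.
End ProxRegular.

(** * The projected Euler scheme *)

Section EulerScheme.
Context {R : realType} {d n : nat}.
Local Notation V := 'rV[R]_d.
Local Notation Z := ('I_n -> V).
Variables (Om : set V) (eta C : R) (G : 'I_n -> Z -> V) (x0 : Z).
Hypotheses (eta0 : 0 < eta) (C0 : 0 <= C).
Hypotheses (cOm : closed Om) (pOm : prox_regular eta Om) (Om0 : forall i, Om (x0 i)).
Hypothesis Ggrowth : forall i X, (forall j, Om (X j)) ->
  enorm (G i X) <= C * (1 + \sum_j enorm (X j)).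

Fixpoint euler (h : R) (k : nat) : Z :=
  if k is k'.+1 then fun i => nproj Om (euler h k' i + h *: G i (euler h k'))
  else x0.

(** The added [1] turns the affine growth bound on [G] into a linear one, ready for a Grönwall
    argument. *)
Definition mass (X : Z) : R := 1 + \sum_j enorm (X j).

Lemma mass_ge1 X : 1 <= mass X.
Proof. by rewrite lerDl sumr_ge0// => j _; exact: enorm_ge0. Qed.

Lemma mass_ge0 X : 0 <= mass X.
Proof. exact: le_trans ler01 (mass_ge1 X). Qed.

Lemma enorm_le_mass X i : enorm (X i) <= mass X.
Proof.
rewrite /mass (bigD1 i)//= addrCA lerDl addr_ge0//.
by rewrite sumr_ge0// => j _; exact: enorm_ge0.
Qed.

Lemma euler_nearest h k i :
  nearest Om (euler h k i + h *: G i (euler h k)) (euler h k.+1 i).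
Proof. by apply: nprojP => //; exists (x0 i). Qed.

Lemma euler_in h k i : Om (euler h k i).
Proof. by case: k => [|k]; [exact: Om0|have [] := euler_nearest h k i]. Qed.

(** The current position competes in the projection, so projecting moves the point by at most
    [h |G|]; the free step costs as much again. *)
Lemma euler_step h k i : 0 <= h ->
  enorm (euler h k.+1 i - euler h k i) <= 2 * h * enorm (G i (euler h k)).
Proof.
move=> h0; have [_ /(_ _ (euler_in h k i))] := euler_nearest h k i.
rewrite (addrC (euler h k i)) addrK enormZ ger0_norm// => hX.
have := ler_enorm_dist (h *: G i (euler h k) + euler h k i) (euler h k.+1 i) (euler h k i).
rewrite addrK enormZ (enormB _ (h *: _ + _)) ger0_norm//; lra.
Qed.

(** Upper bound for half the rate of change of [|p - y|^2] under the velocity [g]; the second term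
    is the curvature error of [prox_ineq]. *)
Definition drift (y g p : V) : R :=
  dotp g (p - y) + enorm g / (2 * eta) * enorm (p - y) ^+ 2.

(* The squared distances telescope along the scheme, so that this discrete evolution
   variational inequality survives the limit without convergence of the velocities. *)
Lemma euler_evi h k i y : 0 <= h -> Om y ->
  enorm (euler h k.+1 i - y) ^+ 2 - enorm (euler h k i - y) ^+ 2 <=
  2 * h * drift y (G i (euler h k)) (euler h k.+1 i).
Proof.
move=> h0 Oy; have nX := euler_nearest h k i.
have hX := nX.2 _ (euler_in h k i).
have hp := prox_ineq eta0 pOm nX Oy.
move: hX hp; rewrite /drift.
move: (euler h k.+1 i) (euler h k i) (G i (euler h k)) => X' X g.
rewrite (addrC X) addrK enormZ ger0_norm// => hX hp.
(* The projection displaces the free step by at most [h |g|], so the curvature error is of order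
   [h]. *)
have hp2 : dotp (h *: g + X - X') (y - X') <=
    h * (enorm g / (2 * eta) * enorm (X' - y) ^+ 2).
  apply: le_trans hp _; rewrite (enormB y) [leRHS]mulrA ler_wpM2r ?sqr_ge0//.
  by rewrite mulrA ler_wpM2r// invr_ge0 mulr_ge0// ltW.
have -> : X - y = (X' - y) - 1 *: (X' - X) by apply/rowP => j; rewrite !mxE; ring.
rewrite sqr_enormBZ.
move: hp2; have -> : h *: g + X - X' = h *: g - (X' - X) by rewrite opprB addrA.
rewrite -(opprB X' y) dotpNr [X in - X <= _]dotpDl dotpNl dotpZl => hp2.
have := sqr_ge0 (enorm (X' - X)); lra.
Qed.

Definition growth (T : R) := expR (2 * n%:R * C * T) * mass x0.

Lemma growth_ge0 T : 0 <= growth T.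
Proof. by rewrite mulr_ge0 ?expR_ge0// mass_ge0. Qed.

Lemma growth_le T T' : T <= T' -> growth T <= growth T'.
Proof.
move=> TT'; rewrite /growth ler_wpM2r ?mass_ge0// ler_expR.
by rewrite ler_wpM2l// !mulr_ge0.
Qed.

(** Discrete Grönwall: by [euler_step] summed over the [n] particles, one step multiplies the mass
    by at most [1 + 2 n C h], which is below [expR (2 n C h)]. *)
Lemma euler_mass h k : 0 <= h -> mass (euler h k) <= growth (h * k%:R).
Proof.
move=> h0; elim: k => [|k IH].
  by rewrite mulr0 /growth mulr0 expR0 mul1r.
have step : mass (euler h k.+1) <= (1 + 2 * n%:R * C * h) * mass (euler h k).
  have hs : \sum_j enorm (euler h k.+1 j) <=
      \sum_j enorm (euler h k j) + n%:R * (2 * h * (C * mass (euler h k))).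
    have -> : n%:R * (2 * h * (C * mass (euler h k))) =
        \sum_(j < n) 2 * h * (C * mass (euler h k)).
      by rewrite sumr_const card_ord mulr_natl.
    rewrite -big_split; apply: ler_sum => j _.
    rewrite -[euler h k.+1 j](subrK (euler h k j)) addrC.
    rewrite (le_trans (ler_enormD _ _))// lerD2l (le_trans (euler_step _ _ h0))//.
    by rewrite ler_wpM2l ?mulr_ge0// Ggrowth// => l; exact: euler_in.
  have -> : (1 + 2 * n%:R * C * h) * mass (euler h k) = 1 +
      (\sum_j enorm (euler h k j) + n%:R * (2 * h * (C * mass (euler h k)))).
    by rewrite mulrDl mul1r {1}/mass; ring.
  by rewrite {1}/mass lerD2l.
apply: le_trans step _.
have -> : growth (h * k.+1%:R) = expR (2 * n%:R * C * h) * growth (h * k%:R).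
  by rewrite /growth mulrA -expRD -natr1; congr (expR _ * _); ring.
apply: ler_pM => //; last exact: expR_ge1Dx.
  by rewrite addr_ge0// !mulr_ge0.
exact: mass_ge0.
Qed.

Definition speed (T : R) := 2 * C * growth T.

Lemma speed_ge0 T : 0 <= speed T.
Proof. by apply: mulr_ge0; [exact: mulr_ge0|exact: growth_ge0]. Qed.

Lemma euler_lipschitz h T k m i : 0 <= h -> h * (k + m)%:R <= T ->
  enorm (euler h (k + m) i - euler h k i) <= h * m%:R * speed T.
Proof.
move=> h0; elim: m => [|m IH] hT.
  by rewrite addn0 subrr enorm0 mulr0 mul0r.
have hT' : h * (k + m)%:R <= T.
  by apply: le_trans hT; rewrite ler_wpM2l// ler_nat addnS.
apply: le_trans (ler_enorm_dist (euler h (k + m) i) _ _) _.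
rewrite -natr1 mulrDr mulr1 mulrDl addrC; apply: lerD; first exact: IH.
have gT : enorm (G i (euler h (k + m))) <= C * growth T.
  apply: le_trans (Ggrowth i (fun j => euler_in h (k + m) j)) _.
  by rewrite ler_wpM2l// (le_trans (euler_mass _ h0))// growth_le.
rewrite addnS; apply: le_trans (euler_step _ _ h0) _.
have -> : h * speed T = 2 * h * (C * growth T) by rewrite /speed; ring.
by rewrite ler_wpM2l// mulr_ge0.
Qed.

End EulerScheme.

(** * Lipschitz functions of a real variable *)

Section LipschitzDerivable.
Context {R : realType}.
Local Notation mu := (@lebesgue_measure R).

Lemma lipschitz_continuous (f : R -> R) (L : R) :
  (forall x y, `|f x - f y| <= L * `|x - y|) -> continuous f.
Proof.
move=> fL x; apply/cvgrPdist_lt => e e0.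
have L0 : 0 <= L by have := fL 1 0; rewrite subr0 normr1 mulr1; exact: le_trans.
near=> y; apply: le_lt_trans (fL _ _) _.
apply: (@le_lt_trans _ _ ((L + 1) * `|x - y|)).
  by rewrite ler_wpM2r// lerDl.
rewrite mulrC -ltr_pdivlMr ?ltr_wpDl//.
near: y; apply: (@cvgr_dist_lt _ _ _ _ _ id x); first exact: cvg_id.
by rewrite divr_gt0// ltr_wpDl.
Unshelve. all: by end_near. Qed.

(** On each half-open interval of a cover the Stieltjes length is at most [L] times the Lebesgue
    length; the infimum over covers transfers this to all measurable sets. *)
Lemma lebesgue_stieltjes_lipschitz (f : cumulative R R) (L : R) : 0 < L ->
  (forall x y, x <= y -> f y - f x <= L * (y - x)) ->
  lebesgue_stieltjes_measure f `<< mu.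
Proof.
move=> L0 fL; apply/null_content_dominatesP => A mA muA0.
apply/eqP; rewrite eq_le measure_ge0 andbT.
suff h : (lebesgue_stieltjes_measure f A <= L%:E * mu A)%E by rewrite muA0 mule0 in h.
rewrite -lee_pdivrMl//.
apply: le_ereal_inf_tmp => _ [F [mF AF] <-].
rewrite lee_pdivrMl//.
have wF k : (wlength f (F k) <= L%:E * wlength idfun (F k))%E.
  have [->|[[a b] /= ab ->]] := (ocitvP _).1 (mF k); first by rewrite !wlength0 mule0.
  by rewrite !wlength_itv_bnd ?(ltW ab)// -EFinM lee_fin fL// ltW.
rewrite -nneseriesZl//.
apply: (@le_trans _ _ (\sum_(k <oo) wlength f (F k))%E).
  by apply: ereal_inf_lbound; exists F.
by apply: lee_nneseries => // k _; exact: wlength_ge0.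
Qed.

(** On []a, b[] the function [f x - f a] is the integral from [a] to [x] of a Radon-Nikodym density,
    hence derivable almost everywhere. *)
Lemma cumulative_lipschitz_derivable (f : cumulative R R) (L a b : R) :
  0 < L -> a <= b -> (forall x y, x <= y -> f y - f x <= L * (y - x)) ->
  {ae mu, forall t, a < t < b -> derivable f t 1}.
Proof.
move=> L0 ab fL.
pose nu := lebesgue_stieltjes_measure f.
have nuE x y : x <= y -> nu `]x, y]%classic = (f y - f x)%:E.
  move=> xy; rewrite /nu /lebesgue_stieltjes_measure /measure_extension.
  by rewrite measurable_mu_extE/=; [rewrite wlength_itv_bnd|exact: is_ocitv].
(* Restricting to []a, b]] makes the Stieltjes measure finite and its density integrable. *)
have mD : measurable (`]a, b]%classic : set (measurableTypeR R)) by exact: measurable_itv.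
have Doo : (nu `]a, b]%classic < +oo)%E by rewrite nuE// ltry.
pose nuD : {finite_measure set (measurableTypeR R) -> \bar R} := mfrestr mD Doo.
have nuDmu : nuD `<< mu.
  apply/null_content_dominatesP => A mA muA0.
  have /null_content_dominatesP h := lebesgue_stieltjes_lipschitz L0 fL.
  apply/eqP; rewrite eq_le measure_ge0 andbT -(h A mA muA0).
  by rewrite /nuD /= /mfrestr /mrestr; exact: measureIl.
have [g [g0 gfin gint gE]] := @radon_nikodym_sigma_finite _ _ _ mu nuD nuDmu.
pose h := fine \o g.
have hint : mu.-integrable setT (EFin \o h).
  by apply: eq_integrable gint => // x _; rewrite /h/= fineK.
have hloc : locally_integrable setT h by apply: open_integrable_locally => //; exact: openT.
have := @FTC1 R h (BRight a) _ hloc.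
have hint' y : mu.-integrable [set` Interval (BRight a) (BRight y)] (EFin \o h).
  by apply: integrableS hint => //; exact: measurable_itv.
move=> /(_ hint'); apply: filterS; first exact: (ae_filter_ringOfSetsType mu).
move=> t /= hF /andP[at_ tb].
have [dF _] := hF at_.
have -> : f = (fun x => (f x - f a) + f a) :> (R -> R).
  by apply/funext => x; rewrite subrK.
apply: derivableD; last exact: derivable_cst.
apply: near_eq_derivable dF.
near=> x.
have : x \in `]a, b[ by near: x; apply: near_in_itvoo; rewrite in_itv/= at_.
rewrite in_itv/= => /andP[/ltW ax /ltW xb].
rewrite /Rintegral.
under eq_integral do rewrite /h/= fineK//.
rewrite -gE; last exact: measurable_itv.
have sub : `]a, x]%classic `<=` (`]a, b]%classic : set R).
  by move=> z /=; rewrite !in_itv/= => /andP[-> /le_trans->].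
by rewrite /nuD/= /mfrestr /mrestr (setIidl sub) -/nu nuE.
Unshelve. all: by end_near. Qed.

(* Rademacher's theorem on the line: [f + M id] is nondecreasing, and its Stieltjes
   measure has a Radon-Nikodym density, to which Lebesgue differentiation applies. *)
Lemma lipschitz_derivable_ae (f : R -> R) (L : R) :
  (forall x y, `|f x - f y| <= L * `|x - y|) -> {ae mu, forall t, derivable f t 1}.
Proof.
move=> fL; have L0 : 0 <= L by have := fL 1 0; rewrite subr0 normr1 mulr1; exact: le_trans.
pose M := L + 1; have M0 : 0 < M by rewrite ltr_wpDl.
pose g x := f x + M * x.
have gB x y : x <= y -> 0 <= g y - g x <= (L + M) * (y - x).
  rewrite -subr_ge0 => xy.
  have := fL y x; rewrite ler_norml (ger0_norm xy) => /andP[h1 h2].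
  have -> : g y - g x = (f y - f x) + L * (y - x) + (y - x) by rewrite /g /M; ring.
  have -> : (L + M) * (y - x) = L * (y - x) + L * (y - x) + (y - x) by rewrite /M; ring.
  by apply/andP; split; lra.
have gnd : nondecreasing g by move=> x y /gB /andP[+ _]; rewrite subr_ge0.
have gc : continuous g.
  apply: (@lipschitz_continuous g (L + M)) => x y.
  have [xy|/ltW xy] := leP x y; have /andP[g1 g2] := gB _ _ xy.
    by rewrite [leLHS]distrC [`|x - y|]distrC (ger0_norm g1) ger0_norm ?subr_ge0.
  by rewrite (ger0_norm g1) ger0_norm ?subr_ge0.
pose c : cumulative R R := HB.pack g (isCumulative.Build R _ R g gnd (right_continuousW gc)).
have LM : 0 < L + M by rewrite ltr_wpDl.
(* The intervals []-n, n[] exhaust the line, so countably many null sets suffice. *)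
have ae n : {ae mu, forall t, - n%:R < t < n%:R -> derivable c t 1}.
  apply: (@cumulative_lipschitz_derivable c (L + M)) => //.
    by rewrite (@le_trans _ _ 0)// oppr_le0.
  by move=> x y /gB/andP[].
have := ae_foralln ae; apply: filterS.
move=> t /= h.
have -> : f = (fun x => g x - M * x) by apply/funext => x; rewrite /g addrK.
apply: derivableB.
  have := h (Num.truncn `|t|).+1; apply; rewrite -ltr_norml.
  exact: truncnS_gt.
exact: derivableM.
Qed.

End LipschitzDerivable.

(** * Passage to the limit *)

Lemma ler_cvg_filter {R : realType} (T : Type) (F : set_system T) {FF : ProperFilter F}
    (f g : T -> R) (l l' : R) :
  f @ F --> l -> g @ F --> l' -> (\forall x \near F, f x <= g x) -> l <= l'.
Proof.
move=> fl gl fg; rewrite -subr_ge0; apply: (cvgr_to_ge (cvgB gl fl)).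
by apply: filterS fg => x; rewrite subr_ge0.
Qed.

Lemma fmap_ultra (T U : Type) (f : T -> U) (F : set_system T) :
  UltraFilter F -> UltraFilter (f @ F).
Proof.
move=> UF; split=> [|H PH FH]; first exact: fmap_proper_filter.
apply/seteqP; split => // A HA.
have [//|FnA] := in_ultra_setVsetC (f @^-1` A) UF.
have HnA : H (~` A) by exact: FH.
by have [x []] := filter_ex (filterI HA HnA).
Qed.

Lemma enorm_ball_compact {R : realType} {d : nat} (M : R) :
  compact [set v : 'rV[R]_d | enorm v <= M].
Proof.
apply: bounded_closed_compact.
  exists M; split; first exact: num_real.
  move=> M' MM' v /= vM; apply: le_trans (ltW MM').
  exact: le_trans (norm_le_enorm v) vM.
exact: ((continuous_closedP _).1 (@enorm_continuous R d) _ (@closed_le _ M)).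
Qed.

(** An ultrafilter on a compact ball converges. One fixed ultrafilter thus gives limits at all times
    at once, with no extraction of subsequences. *)
Lemma ultra_bounded_cvg {R : realType} {d : nat} (T : Type) (F : set_system T)
    (f : T -> 'rV[R]_d) (M : R) :
  UltraFilter F -> (forall t, enorm (f t) <= M) -> exists p : 'rV[R]_d, f @ F --> p.
Proof.
move=> UF fM; have cA := @enorm_ball_compact R d M.
move: cA; rewrite compact_ultra => /(_ (f @ F) (fmap_ultra f UF)) [|p [_ fp]].
  by rewrite /fmap/=; apply: filterE => t; exact: fM.
by exists p.
Qed.

Lemma derivable_enorm {R : realType} {d : nat} (x : R -> 'rV[R]_d) (t e : R) :
  derivable x t 1 -> 0 < e -> exists delta, 0 < delta /\ forall s, s != 0 -> `|s| < delta ->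
    enorm (x (t + s) - x t - s *: derive1 x t) <= e * `|s|.
Proof.
move=> dx e0; have /cvg_enormP /(_ e e0) /nbhs_ballP [delta /= d0 hd] := dx.
exists delta; split => // s s0 sd.
have /hd /(_ s0) /= : ball 0 delta s by rewrite /ball/= sub0r normrN.
rewrite -/('D_1 x t) -derive1E [s *: 1]mulr1 (addrC s) => /ltW h.
have -> : x (t + s) - x t - s *: derive1 x t = s *: (s^-1 *: (x (t + s) - x t) - derive1 x t).
  by rewrite scalerBr scalerA divff// scale1r.
by rewrite enormZ mulrC ler_wpM2r.
Qed.

(** The sign [c] treats both time directions: positions after [t] make the derivative tangent,
    positions before [t] make its opposite tangent. *)
Lemma contingent_derive {R : realType} {d : nat} (S : set 'rV[R]_d) (x : R -> 'rV[R]_d)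
    (t c rho : R) : derivable x t 1 -> `|c| = 1 -> 0 < rho ->
  (forall s, 0 < s -> s < rho -> S (x (t + c * s))) -> contingent S (x t) (c *: derive1 x t).
Proof.
move=> dx c1 rho0 Sx e e0; have [delta [d0 hd]] := derivable_enorm dx e0.
pose h := Num.min e (Num.min delta rho) / 2.
have m0 : 0 < Num.min e (Num.min delta rho) by rewrite !lt_min e0 d0.
have h0 : 0 < h by rewrite divr_gt0.
have : h < Num.min e (Num.min delta rho) by rewrite ltr_pdivrMr// ltr_pMr// ltr1n.
rewrite !lt_min => /and3P[he hdelta hrho].
have ch : `|c * h| = h by rewrite normrM c1 mul1r gtr0_norm.
exists h, (x (t + c * h)); split => //; first exact: Sx.
rewrite scalerA (mulrC h) -[X in e * X]ch; apply: hd; rewrite ?ch//.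
by rewrite -normr_gt0 ch.
Qed.

(* The last hypothesis makes [w - v] polar to the contingent cone; as this cone contains
   both [v] and [- v], the residual [w - v] is also orthogonal to [v]. *)
Lemma tangent_proj_of_polar {R : realType} {d : nat} (S : set 'rV[R]_d) (eta K : R)
    (p w v : 'rV[R]_d) : 0 < eta -> closed S -> prox_regular eta S -> S p -> 0 <= K ->
  contingent S p v -> contingent S p (- v) ->
  (forall y, S y -> dotp (w - v) (y - p) <= K * enorm (y - p) ^+ 2) ->
  tangent_proj S p w v.
Proof.
move=> eta0 cS pS Sp K0 hv hNv hK; split; first exact: (contingent_clarke eta0).
move=> u /(clarke_contingent Sp)/(contingent_polar K0 hK) hu.
have := contingent_polar K0 hK hNv; rewrite dotpNr => hv0.
rewrite -ler_sqr ?nnegrE ?enorm_ge0//.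
(* The cross term [dotp (w - v) (u - v)] is nonpositive by [hu] and [hv0], so replacing [v] by [u]
   cannot shorten the residual. *)
have -> : w - u = (w - v) - 1 *: (u - v) by rewrite scale1r opprB addrA subrK.
rewrite sqr_enormBZ (dotpC (u - v)) [dotp (w - v) (u - v)]dotpDr dotpNr.
have := sqr_ge0 (enorm (u - v)); lra.
Qed.

(** * The ultrafilter limit of the Euler scheme and its differential inclusion *)

Section EulerLimit.
Context {R : realType} {d n : nat}.
Local Notation V := 'rV[R]_d.
Local Notation Z := ('I_n -> V).
Variables (Om : set V) (eta C : R) (G : 'I_n -> Z -> V) (x0 : Z).
Hypotheses (eta0 : 0 < eta) (C0 : 0 <= C).
Hypotheses (cOm : closed Om) (pOm : prox_regular eta Om) (Om0 : forall i, Om (x0 i)).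
Hypothesis Ggrowth : forall i X, (forall j, Om (X j)) ->
  enorm (G i X) <= C * (1 + \sum_j enorm (X j)).
Hypothesis Gcont : forall i (z : Z) (e : R), 0 < e -> exists r : R, 0 < r /\
  forall X : Z, (forall j, enorm (X j - z j) < r) -> enorm (G i X - G i z) < e.
Variable U : set_system nat.
Hypotheses (UU : UltraFilter U) (oU : \oo `<=` U).

Local Notation eul N := (euler Om G x0 (harmonic N)).
Local Notation idx N t := (Num.truncn (t / harmonic N)).
Local Notation spd := (speed C x0).

(** Pointwise ultralimit of the piecewise constant interpolants with step [harmonic N]; [idx N t]
    counts the whole steps up to [t]. For [t >= 0] the limit exists by [euler_limit_cvg], so the
    default [0] is not reached. *)
Definition euler_limit (i : 'I_n) (t : R) : V :=
  xget (0 : V) [set p : V | eul N (idx N t) i @[N --> U] --> p].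

Let h0 N : 0 < harmonic N :> R. Proof. exact: harmonic_gt0. Qed.

Lemma harmonic_ultra : harmonic N @[N --> U] --> (0 : R).
Proof. by apply: cvg_trans cvg_harmonic => A /oU. Qed.

Lemma idx_bounds N (t : R) : 0 <= t ->
  harmonic N * (idx N t)%:R <= t < harmonic N * (idx N t)%:R + harmonic N.
Proof.
move=> t0; have /truncn_itv : 0 <= t / harmonic N by rewrite divr_ge0// ltW.
by rewrite ler_pdivlMr// ltr_pdivrMr// -natr1 mulrDl mul1r ![_ * harmonic N]mulrC.
Qed.

Lemma idx_le N (s t : R) : s <= t -> (idx N s <= idx N t)%N.
Proof. by move=> st; apply: le_truncn; rewrite ler_pM2r ?invr_gt0. Qed.

Lemma euler_limit_cvg i t : 0 <= t ->
  eul N (idx N t) i @[N --> U] --> euler_limit i t.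
Proof.
move=> t0; have [N|p hp] := @ultra_bounded_cvg R d nat U
  (fun N => eul N (idx N t) i) (growth C x0 t) UU.
  apply: le_trans (enorm_le_mass _ i) _.
  apply: le_trans (euler_mass C0 cOm Om0 Ggrowth _ (ltW (h0 N))) _.
  by apply: growth_le => //; have /andP[] := idx_bounds N t0.
exact: (@xgetPex _ (0 : V) [set p : V | eul N (idx N t) i @[N --> U] --> p] (ex_intro _ p hp)).
Qed.

Lemma euler_limit0 i : euler_limit i 0 = x0 i.
Proof.
apply: (@cvg_unique V _ (eul N (idx N 0) i @[N --> U])).
- exact: norm_hausdorff.
- exact: euler_limit_cvg.
- rewrite (_ : (fun N => _) = cst (x0 i)); first exact: cvg_cst.
  by apply/funext => N; rewrite mul0r truncn0.
Qed.

Lemma euler_limit_in i t : 0 <= t -> Om (euler_limit i t).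
Proof.
move=> t0; apply: (@closed_cvg nat V U _ (fun N => eul N (idx N t) i) Om cOm); last exact: euler_limit_cvg.
by apply: filterE => N; exact: euler_in.
Qed.

Lemma euler_diff N k l T i : (k <= l)%N -> harmonic N * l%:R <= T ->
  enorm (eul N l i - eul N k i) <= (harmonic N * l%:R - harmonic N * k%:R) * spd T.
Proof.
move=> kl lT; rewrite -mulrBr -natrB// -{1}(subnKC kl).
by apply: euler_lipschitz => //; [exact: ltW|rewrite subnKC].
Qed.

(** Rounding both times to the grid lengthens the elapsed time by at most one step, which vanishes
    in the limit. *)
Lemma euler_limit_lipschitz i (T s t : R) : 0 <= s -> s <= t -> t <= T ->
  enorm (euler_limit i t - euler_limit i s) <= spd T * (t - s).
Proof.
move=> s0 st tT; have t0 := le_trans s0 st.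
apply: (@ler_cvg_filter _ _ U _ (fun N => enorm (eul N (idx N t) i - eul N (idx N s) i))
  (fun N => spd T * (t - s + harmonic N))).
- by apply: cvg_enorm; apply: cvgB; exact: euler_limit_cvg.
- rewrite -[X in _ --> spd T * X]addr0; apply: cvgM; first exact: cvg_cst.
  by apply: cvgD; [exact: cvg_cst|exact: harmonic_ultra].
apply: filterE => N.
have /andP[a1 a2] := idx_bounds N t0; have /andP[b1 b2] := idx_bounds N s0.
apply: le_trans (euler_diff i (idx_le N st) (le_trans a1 tT)) _.
rewrite mulrC ler_wpM2l ?speed_ge0//; lra.
Qed.

Lemma drift_upper (y g0 p0 : V) (e : R) : 0 < e -> exists r, 0 < r /\
  forall g p, enorm (g - g0) < r -> enorm (p - p0) < r ->
    drift eta y g p < drift eta y g0 p0 + e.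
Proof.
move=> e0.
have cf : drift eta y q.1 q.2 @[q --> nbhs (g0, p0)] --> drift eta y g0 p0.
  have c1 : (fst : V * V -> V) @ nbhs (g0, p0) --> g0 by exact: cvg_fst.
  have c2 : (fun q : V * V => q.2 - y) @ nbhs (g0, p0) --> p0 - y.
    by apply: cvgB; [exact: cvg_snd|exact: cvg_cst].
  apply: cvgD; first exact: cvg_dotp.
  apply: cvgM; first by apply: cvgM; [exact: cvg_enorm|exact: cvg_cst].
  by apply: cvgM; exact: cvg_enorm.
have : \forall q \near (g0, p0), drift eta y q.1 q.2 < drift eta y g0 p0 + e.
  by apply: (cvgr_lt _ cf); rewrite ltrDl.
move=> /nbhs_ballP[r /= r0 hr].
exists r; split => // g p gr pr.
apply: (hr (g, p)).
split; rewrite /= -ball_normE /ball_/= distrC; apply: le_lt_trans (norm_le_enorm _) _ => //.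
Qed.

(** For short times and large [N] all iterates stay near [z], where continuity keeps the drift below
    [D]; summing [euler_evi] over these steps telescopes. *)
Lemma euler_limit_evi i (t0 e : R) (y : V) : 0 <= t0 -> Om y -> 0 < e ->
  exists delta, 0 < delta /\ forall t, t0 <= t <= t0 + delta ->
    enorm (euler_limit i t - y) ^+ 2 - enorm (euler_limit i t0 - y) ^+ 2 <=
    2 * (t - t0) *
      (drift eta y (G i (fun j => euler_limit j t0)) (euler_limit i t0) + e).
Proof.
move=> t00 Oy e0; set z := fun j => euler_limit j t0; set D := _ + e.
have [r1 [r10 hr1]] := drift_upper y (G i z) (z i) e0.
have [r2 [r20 hr2]] := Gcont i z r10.
pose r := Num.min r1 r2.
have r0 : 0 < r by rewrite lt_min r10.
have hr X p : (forall j, enorm (X j - z j) < r) -> enorm (p - z i) < r ->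
    drift eta y (G i X) p <= D.
  move=> hX hp; apply/ltW/hr1; last by apply: lt_le_trans hp _; rewrite ge_min lexx.
  by apply: hr2 => j; apply: lt_le_trans (hX j) _; rewrite ge_min lexx orbT.
(* Closeness [r] is split as [r / 2] for the start at [t0], [r / 4] for the travel during [delta],
   and [r / 4] for one extra grid step. *)
pose L := spd (t0 + 1) + 1.
have L0 : 0 < L by rewrite ltr_wpDl// speed_ge0.
pose delta := Num.min 1 (r / 4 / L).
have d0 : 0 < delta by rewrite lt_min ltr01 !divr_gt0.
have d1 : delta <= 1 by rewrite ge_min lexx.
have d2 : delta * L <= r / 4 by rewrite -ler_pdivlMr// ge_min lexx orbT.
exists delta; split => // t /andP[t0t tdelta].
have tT : t <= t0 + 1 by lra.
have tge0 := le_trans t00 t0t.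
have ev1 : \forall N \near U, harmonic N < r / 4 / L.
  have /cvgrPdist_lt /(_ (r / 4 / L)) := harmonic_ultra.
  rewrite !divr_gt0// => /(_ isT); apply: filterS => N.
  by rewrite sub0r normrN gtr0_norm.
have ev2 : \forall N \near U, forall j, enorm (eul N (idx N t0) j - z j) < r / 2.
  apply: filter_forall => j; have /cvg_enormP := @euler_limit_cvg j t0 t00.
  by apply; rewrite divr_gt0.
(* The elapsed grid time differs from [t - t0] by at most one step; as [D] may have either sign, the
   correction carries its absolute value. *)
apply: (@ler_cvg_filter _ _ U _
  (fun N => enorm (eul N (idx N t) i - y) ^+ 2 - enorm (eul N (idx N t0) i - y) ^+ 2)
  (fun N => 2 * (t - t0) * D + 2 * harmonic N * `|D|)).
- have c s : 0 <= s -> enorm (eul N (idx N s) i - y) ^+ 2 @[N --> U] -->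
      enorm (euler_limit i s - y) ^+ 2.
    move=> s0; have c1 : enorm (eul N (idx N s) i - y) @[N --> U] -->
        enorm (euler_limit i s - y).
      by apply: cvg_enorm; apply: cvgB; [exact: euler_limit_cvg|exact: cvg_cst].
    exact: (cvgM c1 c1).
  by apply: cvgB; exact: c.
- have : 2 * (t - t0) * D + 2 * harmonic N * `|D| @[N --> U] -->
      2 * (t - t0) * D + 2 * 0 * `|D|.
    apply: cvgD; first exact: cvg_cst.
    apply: cvgM; last exact: cvg_cst.
    by apply: cvgM; [exact: cvg_cst|exact: harmonic_ultra].
  by rewrite mulr0 mul0r addr0.
near=> N.
have hN : harmonic N * L < r / 4 by rewrite -ltr_pdivlMr//; near: N.
have hz : forall j, enorm (eul N (idx N t0) j - z j) < r / 2 by near: N.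
have /andP[a1 a2] := idx_bounds N tge0; have /andP[b1 b2] := idx_bounds N t00.
set k0 := idx N t0 in hz b1 b2 *; set k1 := idx N t in a1 a2 *.
have k01 : (k0 <= k1)%N by exact: idx_le.
set h := harmonic N in hN a1 a2 b1 b2 *.
have hp : 0 < h by exact: h0.
have close m j : (k0 + m <= k1)%N -> enorm (eul N (k0 + m) j - z j) < r.
  move=> mk; have hm : h * (k0 + m)%:R <= h * k1%:R by rewrite ler_pM2l// ler_nat.
  have := euler_diff (k := k0) j (leq_addr m k0) (le_trans hm (le_trans a1 tT)).
  rewrite -/h => hd; apply: le_lt_trans (ler_enorm_dist (eul N k0 j) _ _) _.
  have S0 := speed_ge0 x0 C0 (t0 + 1).
  have hd2 : (h * (k0 + m)%:R - h * k0%:R) * spd (t0 + 1) <= (delta + h) * L.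
    apply: ler_pM => //; first by rewrite subr_ge0 ler_pM2l// ler_nat leq_addr.
      lra.
    by rewrite /L; lra.
  have := hz j; rewrite mulrDl in hd2; lra.
have sum m : (k0 + m <= k1)%N ->
    enorm (eul N (k0 + m) i - y) ^+ 2 - enorm (eul N k0 i - y) ^+ 2 <= 2 * (h * m%:R) * D.
  elim: m => [_|m IH mk]; first by rewrite addn0 subrr mulr0 mulr0 mul0r.
  have mk' : (k0 + m <= k1)%N by apply: leq_trans mk; rewrite addnS.
  (* The drift takes the field at the old positions but the new point, so closeness is needed at [m]
     and at [m.+1]. *)
  have hD : drift eta y (G i (eul N (k0 + m))) (eul N (k0 + m).+1 i) <= D.
    by apply: hr => [j|]; [exact: close|rewrite -addnS; exact: close].
  have hd := euler_evi G eta0 cOm pOm Om0 (k0 + m) i (ltW hp) Oy.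
  have hD2 := le_trans hd (ler_wpM2l (mulr_ge0 (ler0n _ 2) (ltW hp)) hD).
  rewrite addnS -[m.+1%:R]natr1.
  have -> : 2 * (h * (m%:R + 1)) * D = 2 * (h * m%:R) * D + 2 * h * D by ring.
  have := IH mk'; rewrite -/h in hD2 *; lra.
have := sum (k1 - k0)%N; rewrite subnKC// natrB// => /(_ (leqnn _)) /le_trans; apply.
rewrite -subr_ge0.
have -> : 2 * (t - t0) * D + 2 * h * `|D| - 2 * (h * (k1%:R - k0%:R)) * D =
  2 * (h * `|D| + ((t - h * k1%:R) - (t0 - h * k0%:R)) * D) by ring.
rewrite mulr_ge0//.
have : `|(t - h * k1%:R) - (t0 - h * k0%:R)| <= h by rewrite ler_norml; apply/andP; split; lra.
move=> hh; have : `|((t - h * k1%:R) - (t0 - h * k0%:R)) * D| <= h * `|D|.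
  by rewrite normrM ler_wpM2r.
by rewrite ler_norml => /andP[+ _]; rewrite -subr_ge0 opprK addrC.
Unshelve. all: by end_near. Qed.

Lemma euler_limit_inclusion i t0 : 0 < t0 -> derivable (euler_limit i) t0 1 ->
  tangent_proj Om (euler_limit i t0) (G i (fun j => euler_limit j t0))
    (derive1 (euler_limit i) t0).
Proof.
move=> t00 dx; set w := G i _; set p := euler_limit i t0; set v := derive1 _ _.
pose K := enorm w / (2 * eta).
have K0 : 0 <= K by rewrite divr_ge0 ?enorm_ge0 ?mulr_ge0// ltW.
apply: (tangent_proj_of_polar eta0 cOm pOm _ K0).
- by apply: euler_limit_in; exact: ltW.
- rewrite -[v]scale1r; apply: (contingent_derive dx (normr1 _) ltr01) => s s0 _.
  by apply: euler_limit_in; rewrite mul1r addr_ge0// ltW.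
- rewrite -scaleN1r; apply: (contingent_derive dx (normrN1 _) t00) => s s0 st0.
  by apply: euler_limit_in; rewrite mulN1r subr_ge0 ltW.
move=> y Oy.
(* Differentiating the evolution inequality at [t0] gives this bound, which rearranges to the
   polarity inequality with constant [K]. *)
suff h : dotp v (p - y) <= drift eta y w p.
  move: h; rewrite /drift -/K (enormB y) -(opprB p) dotpNr [dotp (w - v) _]dotpDl dotpNl; lra.
apply/ler_addgt0Pr => e e0.
(* The tolerance [e / A] is spent once in the evolution inequality and [enorm (p - y)] times in the
   first-order expansion, [e] in total. *)
pose A := 1 + enorm (p - y); have A0 : 0 < A by have := enorm_ge0 (p - y); rewrite /A; lra.
have e'0 : 0 < e / A by rewrite divr_gt0.
have [d1 [d10 hd1]] := euler_limit_evi i (ltW t00) Oy e'0.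
have [d2 [d20 hd2]] := derivable_enorm dx e'0.
pose s := Num.min d1 d2 / 2.
have m0 : 0 < Num.min d1 d2 by rewrite lt_min d10.
have s0 : 0 < s by rewrite divr_gt0.
have : s < Num.min d1 d2 by rewrite ltr_pdivrMr// ltr_pMr// ltr1n.
rewrite lt_min => /andP[sd1 sd2].
have := hd2 s; rewrite gt_eqF// gtr0_norm// => /(_ isT sd2); rewrite -/p -/v.
have := hd1 (t0 + s); rewrite lerDl ltW//= lerD2l ltW// => /(_ isT); rewrite -/p -/w.
move: (euler_limit i (t0 + s)) => q; rewrite (addrC t0) addrK => evi hq.
have qE : q - y = (p - y) - (-1) *: (q - p) by apply/rowP => j; rewrite !mxE; ring.
rewrite qE sqr_enormBZ in evi.
have qpE : q - p = s *: v + (q - p - s *: v) by rewrite [RHS]addrC subrK.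
have h1 : s * dotp v (p - y) <= dotp (q - p) (p - y) + e / A * s * enorm (p - y).
  rewrite qpE dotpDl dotpZl -addrA lerDl -[X in _ <= X + _]opprK addrC subr_ge0 -dotpNl.
  apply: le_trans (dotp_le_enorm _ _) _.
  by rewrite enormN ler_wpM2r ?enorm_ge0.
have h2 := sqr_ge0 (enorm (q - p)).
have h3 : s * dotp v (p - y) <= s * (drift eta y w p + e).
  have -> : s * (drift eta y w p + e) = s * (drift eta y w p + e / A) + e / A * s * enorm (p - y).
    rewrite -{1}[e](divfK (lt0r_neq0 A0)) {2}/A; ring.
  move: h1 evi; lra.
by move: h3; rewrite ler_pM2l.
Qed.

End EulerLimit.

(** * Continuous fields and locally Lipschitz curves *)

Section CurvesAndFields.
Context {R : realType} {d : nat}.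
Local Notation V := 'rV[R]_d.

(** Stating the radius through the filter [0^'+] lets finitely many continuity conditions share one
    radius. *)
Lemma continuous_enorm_near (g : V -> V) (w0 : V) (e : R) : continuous g -> 0 < e ->
  \forall r \near (0 : R)^'+, forall w, enorm (w - w0) < r -> enorm (g w - g w0) < e.
Proof.
move=> cg e0; have /cvg_enormP /(_ e e0) /nbhs_ballP [r /= r0 hr] := cg w0.
near=> s => w ws; apply: hr; rewrite -ball_normE /ball_/= distrC.
apply: le_lt_trans (norm_le_enorm _) _; apply: lt_le_trans ws _.
by near: s; exact: nbhs_right_le.
Unshelve. all: by end_near. Qed.

Lemma continuous_bounded_ball (g : V -> V) (M : R) : continuous g -> 0 <= M ->
  exists K, 0 <= K /\ forall v, enorm v <= M -> enorm (g v) <= K.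
Proof.
move=> cg M0; pose A := [set v : V | enorm v <= M].
have A0 : A 0 by rewrite /A/= enorm0.
have cA : compact A by exact: enorm_ball_compact.
have cf : continuous (fun v => enorm (g v)).
  by move=> v; apply: (@cvg_enorm _ _ _ (nbhs v) _ g (g v)); exact: cg.
have [c _ hc] := EVT_max_rV (ex_intro _ _ A0) cA (continuous_subspaceT cf).
exists (enorm (g c)); split; first exact: enorm_ge0.
by move=> v vM; apply: hc; apply/mem_set.
Qed.

Lemma lipschitz_loc_abs_cont (f : R -> V) :
  (forall T, 0 <= T -> exists2 L, 0 <= L & forall s t, 0 <= s -> s <= t -> t <= T ->
     enorm (f t - f s) <= L * (t - s)) -> loc_abs_cont f.
Proof.
move=> fL T T0 eps eps0; have [L L0 hL] := fL T T0.
have L1 : 0 < L + 1 by rewrite ltr_wpDl.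
exists (eps / (L + 1)); split; first by rewrite divr_gt0.
move=> n l r lr _; rewrite ltr_pdivlMr// => hs; apply: le_lt_trans hs.
rewrite mulr_suml; apply: ler_sum => k _; have [lk [lrk rk]] := lr k.
apply: le_trans (hL _ _ lk lrk rk) _.
by rewrite mulrC ler_wpM2l ?subr_ge0// lerDl.
Qed.

(** Clipping time to [[0, N]] makes each coordinate globally Lipschitz, and the clipped curve agrees
    with [f] near every [t] in []0, N[]. *)
Lemma loc_lipschitz_derivable_ae (f : R -> V) :
  (forall T, 0 <= T -> exists2 L, 0 <= L & forall s t, 0 <= s -> s <= t -> t <= T ->
     enorm (f t - f s) <= L * (t - s)) ->
  {ae (@lebesgue_measure R), forall t, 0 < t -> derivable f t 1}.
Proof.
move=> fL; pose clip (N : nat) (t : R) := Num.max 0 (Num.min t N%:R).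
have clip0 N t : 0 <= clip N t by rewrite le_max lexx.
have clipN N t : clip N t <= N%:R by rewrite ge_max ler0n ge_min lexx orbT.
have ae N j : {ae (@lebesgue_measure R), forall t : R,
    derivable (fun t => f (clip N t) ord0 j) t 1}.
  have [L L0 hL] := fL N%:R (ler0n _ _).
  have le_case s t : s <= t -> `|f (clip N t) ord0 j - f (clip N s) ord0 j| <= L * `|t - s|.
    move=> st; have c1 : clip N s <= clip N t.
      by rewrite /clip; rewrite ge_max !le_max lexx/= le_min !ge_min st lexx !orbT.
    have c2 : clip N t - clip N s <= t - s.
      rewrite lerBlDr {1}/clip ge_max; apply/andP; split.
        by rewrite addr_ge0 ?subr_ge0.
      have : Num.min s N%:R <= clip N s by rewrite /clip le_max lexx orbT.
      by rewrite ge_min !ge_min => /orP[sc|Nc]; apply/orP; [left|right]; lra.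
    have := coord_le_enorm (f (clip N t) - f (clip N s)) j; rewrite !mxE => /le_trans; apply.
    apply: le_trans (hL _ _ (clip0 N s) c1 (clipN N t)) _.
    by rewrite ler_wpM2l// (le_trans c2)// ler_norm.
  apply: (@lipschitz_derivable_ae _ _ L) => s t.
  have [/le_case|/ltW/le_case //] := leP s t.
  by rewrite distrC [`|s - t|]distrC.
have aeN N : {ae (@lebesgue_measure R), forall t : R, forall j,
    derivable (fun t => f (clip N t) ord0 j) t 1}.
  by apply: filter_forall => j; exact: ae.
have := ae_foralln aeN; apply: filterS => t h t0.
apply/derivable_mxP => i j; rewrite (ord1 i).
have tN : t < (Num.truncn t).+1%:R by exact: truncnS_gt.
have := h (Num.truncn t).+1 j; apply: near_eq_derivable.
near=> s.
have : s \in `]0, (Num.truncn t).+1%:R[.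
  by near: s; apply: near_in_itvoo; rewrite in_itv/= t0.
rewrite in_itv/= => /andP[s0 sN].
by rewrite /clip min_l ?(ltW sN)// max_r// ltW.
Unshelve. all: by end_near. Qed.

End CurvesAndFields.

(** * Existence for the interaction system *)

Unset Implicit Arguments.

Theorem theorem2p6 (R : realType) (d : nat) (Om : set 'rV[R]_d) (eta : R)
  (W V : 'rV[R]_d -> R) (gW gV : 'rV[R]_d -> 'rV[R]_d) :
  0 < eta -> closed Om -> prox_regular eta Om ->
  C1_grad W gW -> C1_grad V gV ->
  (  (ebounded Om /\
      (exists lamW : R, geod_convex lamW W gW (conv_hull (set_diff_minus Om))) /\
      (exists lamV : R, geod_convex lamV V gV (conv_hull Om)))
   \/ (~ ebounded Om /\
      exists C : R, forall x, enorm (gW x) <= C * (1 + enorm x) /\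
                              enorm (gV x) <= C * (1 + enorm x))) ->
  forall (n : nat) (x0 : 'I_n -> 'rV[R]_d) (m : 'I_n -> R),
    (forall i, Om (x0 i)) -> (forall i, 0 <= m i) -> \sum_(i < n) m i = 1 ->
    exists x : 'I_n -> R -> 'rV[R]_d,
      (forall i, x i 0 = x0 i) /\
      (forall i, loc_abs_cont (x i)) /\
      (forall i t, 0 <= t -> Om (x i t)) /\
      {ae (@lebesgue_measure R), forall t : R, 0 <= t -> forall i,
         derivable (x i) t 1 /\
         tangent_proj Om (x i t)
           (- (\sum_(j < n) m j *: gW (x i t - x j t)) - gV (x i t))
           (derive1 (x i) t)}.
Proof.
move=> eta0 cOm pOm [cW _] [cV _] hyp n x0 m Om0 m0 m1.
pose G (i : 'I_n) (X : 'I_n -> 'rV[R]_d) : 'rV[R]_d :=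
  - (\sum_(j < n) m j *: gW (X i - X j)) - gV (X i).
(* Both alternatives reduce to linear growth for points of [Om]: when [Om] is bounded by [M],
   differences stay within [2 * |M|]. *)
have [C [C0 hC]] : exists C : R, 0 <= C /\ forall x y, Om x -> Om y ->
    enorm (gW (x - y)) <= C * (1 + enorm x + enorm y) /\ enorm (gV x) <= C * (1 + enorm x).
  case: hyp => [[[M hM] _]|[_ [C hC]]].
    have [K1 [K10 hK1]] := continuous_bounded_ball cW (mulr_ge0 (ler0n _ 2) (normr_ge0 M)).
    have [K2 [K20 hK2]] := continuous_bounded_ball cV (normr_ge0 M).
    have hM' x : Om x -> enorm x <= `|M| by move=> /hM /le_trans; apply; exact: ler_norm.
    exists (K1 + K2); split => [|x y Ox Oy]; first exact: addr_ge0.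
    have x0' := enorm_ge0 x; have y0' := enorm_ge0 y.
    have xM := hM' x Ox; have yM := hM' y Oy.
    have h1 : enorm (gW (x - y)) <= K1.
      by apply: hK1; apply: le_trans (ler_enormB _ _) _; lra.
    have h2 : enorm (gV x) <= K2 by exact: hK2.
    split; last by apply: (le_trans h2); rewrite mulrDr mulr1 -addrA addrCA lerDl addr_ge0 ?mulr_ge0 ?addr_ge0.
    by apply: (le_trans h1); rewrite !mulrDr mulr1 -!addrA lerDl !addr_ge0// mulr_ge0// addr_ge0.
  (* The given [C] comes with no sign, whereas the scheme needs a nonnegative constant. *)
  exists `|C|; split => // x y _ _; have Cle := ler_norm C.
  have x0' := enorm_ge0 x; have y0' := enorm_ge0 y.
  have xy0 := enorm_ge0 (x - y).
  have [h1 _] := hC (x - y); have [_ h2] := hC x.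
  have h3 := ler_enormB x y; have C0' := normr_ge0 C.
  split.
    apply: le_trans h1 _; apply: (@le_trans _ _ (`|C| * (1 + enorm (x - y)))).
      by rewrite ler_wpM2r// addr_ge0.
    by rewrite ler_wpM2l//; lra.
  by apply: le_trans h2 _; rewrite ler_wpM2r// addr_ge0.
(* Since the weights sum to one, the interaction costs [C (1 + 2 S)] and the potential [C (1 + S)],
   together at most [3 C (1 + S)]. *)
have Ggrowth i X : (forall j, Om (X j)) ->
    enorm (G i X) <= 3 * C * (1 + \sum_j enorm (X j)).
  move=> OX; set S := \sum_j _.
  have XS j : enorm (X j) <= S.
    by rewrite /S (bigD1 j)//= lerDl sumr_ge0// => k _; exact: enorm_ge0.
  have S0 : 0 <= S by rewrite sumr_ge0// => k _; exact: enorm_ge0.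
  have h1 : enorm (\sum_(j < n) m j *: gW (X i - X j)) <= C * (1 + S + S).
    apply: le_trans (ler_enorm_sum _ _ _) _.
    have -> : C * (1 + S + S) = \sum_j m j * (C * (1 + S + S)).
      by rewrite -mulr_suml m1 mul1r.
    apply: ler_sum => j _.
    rewrite enormZ ger0_norm// ler_wpM2l//.
    have [h _] := hC _ _ (OX i) (OX j); apply: le_trans h _.
    by rewrite ler_wpM2l//; have := XS i; have := XS j; lra.
  have h2 : enorm (gV (X i)) <= C * (1 + S).
    have [_ h] := hC _ _ (OX i) (OX i); apply: le_trans h _.
    by rewrite ler_wpM2l//; have := XS i; lra.
  apply: le_trans (ler_enormB _ _) _; rewrite enormN.
  have -> : 3 * C * (1 + S) = C * (1 + S + S) + C * (1 + S) + C by ring.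
  lra.
have Gcont i (z : 'I_n -> 'rV[R]_d) (e : R) : 0 < e -> exists r : R, 0 < r /\
    forall X : 'I_n -> 'rV[R]_d, (forall j, enorm (X j - z j) < r) ->
      enorm (G i X - G i z) < e.
  move=> e0; have e3 : 0 < e / 3 by rewrite divr_gt0.
  have nW : \forall r \near (0 : R)^'+, forall j, forall w,
      enorm (w - (z i - z j)) < r -> enorm (gW w - gW (z i - z j)) < e / 3.
    by apply: filter_forall => j; exact: continuous_enorm_near.
  have nV := continuous_enorm_near (z i) cV e3.
  near (0 : R)^'+ => r.
  have r0 : 0 < r by near: r; exact: nbhs_right_gt.
  have hW : forall j w, enorm (w - (z i - z j)) < r ->
      enorm (gW w - gW (z i - z j)) < e / 3 by near: r.
  have hV : forall w, enorm (w - z i) < r -> enorm (gV w - gV (z i)) < e / 3 by near: r.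
  (* A difference of two positions moves by the sum of their displacements, hence half the
     radius. *)
  exists (r / 2); split; first by rewrite divr_gt0.
  move=> X hX.
  have h1 : enorm (\sum_(j < n) m j *: (gW (X i - X j) - gW (z i - z j))) <= e / 3.
    apply: le_trans (ler_enorm_sum _ _ _) _.
    have -> : e / 3 = \sum_j m j * (e / 3) by rewrite -mulr_suml m1 mul1r.
    apply: ler_sum => j _.
    have XX : enorm (X i - X j - (z i - z j)) < r.
      have -> : X i - X j - (z i - z j) = (X i - z i) - (X j - z j).
        by apply/rowP => k; rewrite !mxE; ring.
      apply: le_lt_trans (ler_enormB _ _) _; have := hX i; have := hX j; lra.
    by rewrite enormZ ger0_norm// ler_wpM2l//; exact: ltW (hW _ _ XX).
  have h2 : enorm (gV (X i) - gV (z i)) < e / 3 by apply: hV; have := hX i; lra.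
  have -> : G i X - G i z = - (\sum_(j < n) m j *: (gW (X i - X j) - gW (z i - z j)))
      - (gV (X i) - gV (z i)).
    under eq_bigr do rewrite scalerBr.
    by rewrite sumrB /G; apply/rowP => k; rewrite !mxE; ring.
  apply: le_lt_trans (ler_enormB _ _) _; rewrite enormN; lra.
(* An ultrafilter refining [\oo] keeps all ordinary limits, in particular that of the step sizes. *)
have [U [UU oU]] := ultraFilterLemma (_ : ProperFilter \oo).
have C30 : 0 <= 3 * C by rewrite mulr_ge0.
pose x := euler_limit Om G x0 U.
have xL i T : 0 <= T -> exists2 L, 0 <= L & forall s t, 0 <= s -> s <= t -> t <= T ->
    enorm (x i t - x i s) <= L * (t - s).
  move=> T0; exists (speed (3 * C) x0 T); first exact: speed_ge0.
  by move=> s t; apply: euler_limit_lipschitz.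
exists x; split; first by move=> i; exact: (euler_limit0 C30 cOm Om0 Ggrowth UU).
split; first by move=> i; exact: lipschitz_loc_abs_cont (xL i).
split; first by move=> i t t0; exact: (euler_limit_in C30 cOm Om0 Ggrowth UU).
(* The inclusion is proved at positive times; the initial time is a null set. *)
have ae0 : {ae (@lebesgue_measure R), forall t : R, t != 0}.
  exists [set 0]; split; [exact: measurable_set1|exact: lebesgue_measure_set1|].
  by move=> t /= /negP; rewrite negbK => /eqP.
have aeD : {ae (@lebesgue_measure R), forall t : R, forall i, 0 < t -> derivable (x i) t 1}.
  by apply: filter_forall => i; exact: (loc_lipschitz_derivable_ae (xL i)).
apply: (@filterS2 _ _ (ae_filter_ringOfSetsType _) _ _ _ _ ae0 aeD) => t t0 ht tge0 i.
have tp : 0 < t by rewrite lt_def t0.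
have dx := ht i tp; split => //.
exact: (euler_limit_inclusion eta0 C30 cOm pOm Om0 Ggrowth Gcont UU oU tp dx).
Unshelve. all: by end_near. Qed.
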